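(* Let $N,M\in\mathbb{N}$ with $M\ge N\ge 2$, let $s>0$, and let $\Phi=\mathrm{HTF}(N,M,s)\subset\mathbb{C}^N$ be the harmonic tight frame of $M$ vectors in $\mathbb{C}^N$. Let $$D_{M,N}=\{d\in\{N,\dots,M-N\} : d \text{ is a divisor of } M\}.$$ Then $\Phi$ is prime if and only if $D_{M,N}=\emptyset$. In particular, if $M$ is a prime number, then $\Phi$ is prime.
   Context: For $M\ge N$ and $s>0$, put $\gamma=e^{2\pi i/M}$. The harmonic tight frame $\mathrm{HTF}(N,M,s)$ is the collection $\{\varphi_k\}_{k=0}^{M-1}\subset\mathbb{C}^N$ with $$\varphi_k=\sqrt{\tfrac{s}{N}}\,\bigl(1,\gamma^{k},\gamma^{2k},\dots,\gamma^{(N-1)k}\bigr)^{T}.$$ It is a tight frame with bound $sM/N$. A finite collection $\{\varphi_i\}\subset\mathbb{C}^N$ is a tight frame for $\mathbb{C}^N$ if there is $A>0$ with $\sum_i|\langle x,\varphi_i\rangle|^2=A\|x\|^2$ for all $x\in\mathbb{C}^N$. A tight frame is prime if no proper sub-collection (indexed by a proper subset of the index set) is a tight frame for $\mathbb{C}^N$. The set $\{N,\dots,M-N\}$ is empty if $M<2N$. *)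

(* Defs.v *)
From mathcomp Require Import all_boot all_order all_algebra.
From mathcomp Require Import classical_sets reals trigo complex.

Set Implicit Arguments.
Unset Strict Implicit.
Unset Printing Implicit Defensive.

Import Order.TTheory GRing.Theory Num.Theory.
Local Open Scope ring_scope.

Definition cdot (R : realType) (N : nat) (x y : 'cV[R[i]]_N) : R[i] :=
  \sum_(j < N) x j 0 * (y j 0)^*.

(* The order on [R[i]] is partial and [`|z|] is the modulus embedded in [R[i]],
   so the equality below is between real numbers seen as complex numbers. *)
Definition tight_frame (R : realType) (N : nat) (I : finType)
    (phi : I -> 'cV[R[i]]_N) : Prop :=
  exists2 A : R, 0 < A &
    forall x : 'cV[R[i]]_N,
      \sum_(i : I) `|cdot x (phi i)| ^+ 2 = A%:C%C * cdot x x.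

(* Sub-collections are indexed by subsets of the index type, so that repeated
   vectors are counted with multiplicity. *)
Definition subcollection (T : Type) (I : finType) (phi : I -> T) (J : {set I}) :
    {i : I | i \in J} -> T :=
  fun i => phi (val i).
Arguments subcollection {T I} phi J i.

Definition prime_tight_frame (R : realType) (N : nat) (I : finType)
    (phi : I -> 'cV[R[i]]_N) : Prop :=
  tight_frame phi /\
  forall J : {set I}, J \proper [set: I]%SET ->
    ~ tight_frame (subcollection phi J).

(* e^{i t} for real t *)
Definition expi (R : realType) (t : R) : R[i] := (cos t +i* sin t)%C.

Definition HTF (R : realType) (N M : nat) (s : R) : 'I_M -> 'cV[R[i]]_N :=
  fun k => \col_(j < N)
    ((Num.sqrt (s / N%:R))%:C%C * expi (2 * pi / M%:R) ^+ (j * k)).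
Arguments HTF {R} N M s k.

(* When M < 2N the interval of admissible d is empty, also when the
   subtraction is truncated. *)
Definition divisor_set (M N : nat) : set nat :=
  [set d : nat | (N <= d <= M - N)%N /\ (d %| M)%N]%classic.

(* Main.v *)
(* Expanding the frame operator, the vectors indexed by J form a tight frame
   iff J is nonempty and p_J(x) = sum_(k in J) x^k vanishes at gamma^m for
   0 < m < N.  If d divides M and N <= d <= M - N, the multiples of M / d give
   a proper such J.  Conversely p_J has rational coefficients, so vanishing at
   gamma^m only depends on gcd(m, M); when every proper divisor of M is smaller
   than N, p_J vanishes at all gamma^m with 0 < m < M, and by Fourier inversion
   the indicator function of J is constant. *)
Require Import Defs.
From mathcomp Require Import all_boot all_order all_algebra all_field.
From mathcomp Require Import classical_sets reals trigo complex.
From mathcomp Require Import ring lra zify.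
Import Order.TTheory GRing.Theory Num.Theory.
Local Open Scope ring_scope.

(** * Cyclotomic polynomials and conjugate primitive roots *)

(** ['X^n - 1] is the product of the ['Phi_d] with [d %| n]; a root [z] of a factor with [d] proper
    would satisfy [z ^+ d = 1], against primitivity. *)
Lemma root_Cyclotomic (F : fieldType) (n : nat) (z : F) :
  n.-primitive_root z -> root (map_poly intr 'Phi_n) z.
Proof.
move=> prim_z; have n_gt0 := prim_order_gt0 prim_z.
have: root (map_poly intr ('X^n - 1)) z.
  rewrite rmorphB rmorph1 /= map_polyXn /root !hornerE.
  by rewrite (prim_expr_order prim_z) subrr.
rewrite -prod_Cyclotomic // (big_rem n) -?dvdn_divisors //= rmorphM rootM.
case/orP=> //; rewrite rmorph_prod -(big_map _ xpredT id).
apply: contraTT => _; rewrite root_bigmul; apply/allP => _ /mapP[d dn ->].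
apply/negP => Phi_d0.
move: dn; rewrite mem_rem_uniq ?divisors_uniq // inE /= -dvdn_divisors //.
case/andP=> d_neq_n d_dvd_n; have d_gt0 := dvdn_gt0 n_gt0 d_dvd_n.
have: root (map_poly intr ('X^d - 1)) z.
  rewrite -prod_Cyclotomic // (big_rem d) -?dvdn_divisors //=.
  by rewrite rmorphM rootM Phi_d0.
rewrite rmorphB rmorph1 /= map_polyXn /root !hornerE subr_eq0.
rewrite -(prim_order_dvd prim_z) => n_dvd_d.
by move: d_neq_n; rewrite eqn_dvd d_dvd_n n_dvd_d.
Qed.

(* Irreducibility of 'Phi_n is only available through minimal polynomials in
   algC: a common root in F makes gcd('Phi_n, p) nonconstant, and this gcd then
   has a root in algC, which is again a primitive n-th root. *)
Lemma Cyclotomic_dvdp (F : numFieldType) (n : nat) (z : F) (p : {poly rat}) :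
  n.-primitive_root z -> root (map_poly ratr p) z ->
  map_poly intr 'Phi_n %| p.
Proof.
move=> prim_z pz0; have n_gt0 := prim_order_gt0 prim_z.
have ratrZ (K : numFieldType) (q : {poly int}) :
    map_poly ratr (map_poly intr q : {poly rat}) = map_poly intr q :> {poly K}.
  by rewrite -map_poly_comp; apply: eq_map_poly => a; rewrite /= ratr_int.
pose Phi : {poly rat} := map_poly intr 'Phi_n.
have gz0 : root (map_poly ratr (gcdp Phi p)) z.
  by rewrite gcdp_map root_gcd pz0 ratrZ root_Cyclotomic.
have g_neq1 : size (map_poly (ratr : rat -> algC) (gcdp Phi p)) != 1%N.
  rewrite size_map_poly; apply/negP => /size_poly1P[c c_neq0 gc].
  move: gz0; rewrite gc map_polyC /= rootC /= fmorph_eq0.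
  by apply/negP.
have [w] := closed_rootP _ g_neq1.
rewrite gcdp_map root_gcd ratrZ => /andP[Phi_w pw0].
have [v prim_v] := C_prim_root_exists n_gt0.
have prim_w : n.-primitive_root w.
  by rewrite -(root_cyclotomic prim_v) -(Cintr_Cyclotomic prim_v).
have [q [qE _] q_dvd] := minCpolyP w.
rewrite -/Phi -(_ : q = Phi) -?q_dvd //.
apply: (map_inj_poly (fmorph_inj (ratr : {rmorphism rat -> algC}))) => //.
  by rewrite rmorph0.
by rewrite -qE ratrZ (minCpoly_cyclotomic prim_w) (Cintr_Cyclotomic prim_w).
Qed.

(** Galois conjugacy: the sum is the value at [z] of a polynomial with rational coefficients, hence
    a multiple of ['Phi_n], which also kills [w]. *)
Lemma sum_prim_root_conj (F : numFieldType) (n : nat) (z w : F)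
    (I : finType) (P : pred I) (k : I -> nat) :
  n.-primitive_root z -> n.-primitive_root w ->
  \sum_(i | P i) z ^+ k i = 0 -> \sum_(i | P i) w ^+ k i = 0.
Proof.
move=> prim_z prim_w; pose p : {poly rat} := \sum_(i | P i) 'X^(k i).
have pE x : (map_poly ratr p).[x] = \sum_(i | P i) x ^+ k i :> F.
  rewrite rmorph_sum horner_sum; apply: eq_bigr => i _ /=.
  by rewrite map_polyXn hornerXn.
rewrite -!pE => pz0.
have /(Cyclotomic_dvdp _ _ _ _ prim_z) : root (map_poly ratr p) z by apply/eqP.
rewrite -(dvdp_map (ratr : rat -> F)) => /dvdpP[q ->].
rewrite hornerM -map_poly_comp.
rewrite (@eq_map_poly _ _ _ intr) => [|a]; last by rewrite /= ratr_int.
by have /eqP-> := root_Cyclotomic _ _ _ prim_w; rewrite mulr0.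
Qed.

(** * Geometric and Fourier sums over roots of unity *)

Lemma sum_root1 (F : idomainType) (w : F) (n : nat) :
  w ^+ n = 1 -> w != 1 -> \sum_(i < n) w ^+ i = 0.
Proof.
move=> wn w_neq1; have /esym/eqP := subrX1 w n.
by rewrite wn subrr mulf_eq0 subr_eq0 (negPf w_neq1) => /eqP.
Qed.

(* Inverse discrete Fourier transform at a point outside [J]. *)
Lemma card_fourier_eq0 (F : numFieldType) (M : nat) (z : F) (J : {set 'I_M})
    (j : 'I_M) :
  M.-primitive_root z -> j \notin J ->
  (forall m, (0 < m < M)%N -> \sum_(k in J) z ^+ (m * k) = 0) -> #|J| = 0%N.
Proof.
move=> prim_z jJ J0; apply/eqP; rewrite -(pnatr_eq0 F).
(* [k + (M - j)] stands for [k - j] modulo [M]. Summing over [k] first, only [m = 0] contributes;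
   summing over [m] first, each term is a geometric sum of ratio different from 1, as [j] is not in
   [J]. *)
pose S := \sum_(m < M) \sum_(k in J) z ^+ (m * (k + (M - j))).
have <- : S = #|J|%:R.
  rewrite /S (bigD1 (Ordinal (prim_order_gt0 prim_z))) //= [X in _ + X]big1 => [|m m_neq0].
    by rewrite addr0 -sumr_const; apply: eq_bigr => k _; rewrite /= expr0.
  under eq_bigr do rewrite mulnDr exprD.
  by rewrite -mulr_suml J0 ?mul0r // ltn_ord lt0n andbT.
rewrite /S exchange_big big1 //= => k kJ.
under eq_bigr do rewrite mulnC exprM.
apply: sum_root1; first by rewrite exprAC (prim_expr_order prim_z) expr1n.
rewrite -(prim_order_dvd prim_z) addnBA ?(ltnW (ltn_ord j)) //.
apply: contraNN jJ => dvdM; suff -> : j = k by [].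
apply/val_inj/esym/eqP; rewrite /= -(modn_small (ltn_ord k)).
rewrite -[X in _ == X](modn_small (ltn_ord j)) -(eqn_modDr (M - j)).
by rewrite subnKC ?(ltnW (ltn_ord j)) // modnn addnBA ?(ltnW (ltn_ord j)).
Qed.

(** * Complex exponentials and the inner product *)

Section Frames.
Variables (R : realType).
Implicit Types (t : R).

Lemma expiD t u : expi (t + u) = expi t * expi u.
Proof.
rewrite /expi cosD sinD; apply/eqP; rewrite eq_complex /= eqxx.
by apply/eqP; ring.
Qed.

Lemma expi_expr t n : expi t ^+ n = expi (t *+ n).
Proof.
elim: n => [|n IHn]; first by rewrite mulr0n expr0 /expi cos0 sin0.
by rewrite exprS IHn -expiD mulrS.
Qed.

(** Half-angle formula: [cos t] is 1 minus twice the square of [sin (t / 2)], and [t / 2] lies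
    strictly between 0 and [pi]. *)
Lemma cos_lt1 t : 0 < t < pi *+ 2 -> cos t < 1.
Proof.
move=> /andP[t_gt0 t_lt].
have s_gt0 : 0 < sin (t / 2).
  by apply: sin_gt0_pi; rewrite divr_gt0 //= ltr_pdivrMr // mulr_natr.
rewrite (splitr t) -mulr2n cos_mulr2n cos2sin2.
have := exprn_gt0 2 s_gt0; lra.
Qed.

Lemma expi_prim_root M : (0 < M)%N ->
  M.-primitive_root (expi (2 * pi / M%:R) : R[i]).
Proof.
move=> M_gt0; have M_neq0 : M%:R != 0 :> R by rewrite pnatr_eq0 -lt0n.
apply/andP; split=> //; apply/forallP => k; rewrite unity_rootE expi_expr.
have -> : 2 * pi / M%:R *+ k.+1 = (pi *+ 2) * (k.+1%:R / M%:R) :> R by field.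
apply/eqP; case: (eqVneq k.+1 M) => [->|k_neq].
  by rewrite divff // mulr1 /expi cos2pi sin2pi eqxx.
(* Comparing real parts suffices: the angle lies strictly between 0 and [pi *+ 2], where the cosine
   is below 1. *)
apply/negP => /eqP[cos1 _].
have k_lt : (k.+1 < M)%N by rewrite ltn_neqAle k_neq ltn_ord.
suff: cos ((pi *+ 2) * (k.+1%:R / M%:R)) < 1 :> R by rewrite cos1 ltxx.
have pi2 : 0 < pi *+ 2 :> R by rewrite pmulrn_lgt0 // pi_gt0.
apply: cos_lt1; rewrite mulr_gt0 ?divr_gt0 ?ltr0n //=.
by rewrite gtr_pMr // ltr_pdivrMr ?ltr0n // mul1r ltr_nat.
Qed.

Lemma expi_conj t : expi t * (expi t)^* = 1.
Proof.
apply/eqP; rewrite eq_complex /=; apply/andP; split; apply/eqP.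
  by rewrite -(cos2Dsin2 t); ring.
by ring.
Qed.


Lemma cdotD N (x y z : 'cV[R[i]]_N) : cdot (x + y) z = cdot x z + cdot y z.
Proof. by rewrite -big_split; apply: eq_bigr => j _; rewrite mxE mulrDl. Qed.

Lemma cdotZ N (c : R[i]) (x z : 'cV[R[i]]_N) : cdot (c *: x) z = c * cdot x z.
Proof. by rewrite mulr_sumr; apply: eq_bigr => j _; rewrite mxE mulrA. Qed.

Lemma cdot_delta N (a : 'I_N) (z : 'cV[R[i]]_N) :
  cdot (delta_mx a 0) z = (z a 0)^*.
Proof.
rewrite /cdot (bigD1 a) //= big1 => [|j /negPf ja]; last first.
  by rewrite mxE ja mul0r.
by rewrite mxE !eqxx mul1r addr0.
Qed.

(** * Tightness and primality of harmonic frames *)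

Section HarmonicFrame.
Variables (N M : nat) (s : R).
Hypotheses (N_gt0 : (0 < N)%N) (s_gt0 : 0 < s).

Local Notation gamma := (expi (2 * pi / M%:R) : R[i]).
Local Notation c0 := ((Num.sqrt (s / N%:R))%:C%C).

Let c0_conj : c0^* = c0.
Proof. by apply/eqP; rewrite eq_complex /= oppr0 !eqxx. Qed.

Let c0_sqr : c0 * c0 = (s / N%:R)%:C%C.
Proof. by rewrite -rmorphM -expr2 sqr_sqrtr // divr_ge0 ?ler0n // ltW. Qed.

Let sN_gt0 : 0 < s / N%:R.
Proof. by rewrite divr_gt0 ?ltr0n. Qed.

Let gamma_conj n : gamma ^+ n * (gamma ^+ n)^* = 1.
Proof. by rewrite rmorphXn -exprMn expi_conj expr1n. Qed.

Lemma sum_cdot_HTF (I : finType) (k : I -> 'I_M) (x : 'cV[R[i]]_N) :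
  \sum_i `|cdot x (HTF N M s (k i))| ^+ 2 = (s / N%:R)%:C%C *
    \sum_(a < N) \sum_(b < N) x a 0 * (x b 0)^* *
      \sum_i gamma ^+ (b * k i) * (gamma ^+ (a * k i))^*.
Proof.
under [in RHS]eq_bigr do under eq_bigr do rewrite mulr_sumr.
under [in RHS]eq_bigr do rewrite exchange_big /=.
rewrite exchange_big mulr_sumr; apply: eq_bigr => i _ /=.
rewrite normCK rmorph_sum /= mulr_suml mulr_sumr; apply: eq_bigr => a _.
rewrite !mulr_sumr; apply: eq_bigr => b _.
rewrite -c0_sqr !mxE !rmorphM /= !conjCK c0_conj.
ring.
Qed.

(** An arbitrary index map [k] covers both the whole frame and its subcollections. The sums over [i]
    are the off-diagonal entries of the frame operator, up to scaling and conjugation. *)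
Lemma tight_frame_HTF (I : finType) (k : I -> 'I_M) :
  tight_frame (fun i => HTF N M s (k i)) <->
  (0 < #|I|)%N /\
  forall m, (0 < m < N)%N -> \sum_i gamma ^+ (m * k i) = 0.
Proof.
split=> [[A A_gt0 tightA]|[I_gt0 gamma0]].
  pose o := Ordinal N_gt0.
  (* Testing on [e_0] determines the bound, since all frame vectors have the same first
     coordinate. *)
  have AE : (A%:C)%C = (s / N%:R)%:C%C * #|I|%:R.
    have := tightA (delta_mx o 0).
    rewrite cdot_delta mxE !eqxx rmorph1 mulr1 => <-.
    rewrite mulr_natr -sumr_const; apply: eq_bigr => i _.
    by rewrite cdot_delta mxE mul0n expr0 mulr1 c0_conj normCK c0_conj c0_sqr.
  split=> [|m /andP[m_gt0 m_lt]].
    rewrite lt0n; apply: contraTneq A_gt0 => I0.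
    by move: AE; rewrite I0 mulr0 => -[->]; rewrite ltxx.
  (* Test tightness on e_0 + S e_m, where S is the sum to be killed. *)
  pose b := Ordinal m_lt; set S := \sum_i _.
  have bo : (b == o) = false by apply/negbTE; rewrite -lt0n.
  have := tightA (delta_mx o 0 + S *: delta_mx b 0).
  rewrite cdotD cdotZ !cdot_delta !mxE !eqxx bo eq_sym bo /=.
  rewrite !mulr0 !mulr1 addr0 add0r rmorph1 AE.
  have -> : \sum_i `|cdot (delta_mx o 0 + S *: delta_mx b 0)
      (HTF N M s (k i))| ^+ 2 =
    (s / N%:R)%:C%C * (#|I|%:R * (1 + S * S^*) + (S * S^* + S^* * S)).
    transitivity (\sum_i (s / N%:R)%:C%C * (1 + S * S^* +
       (S * (gamma ^+ (m * k i))^* + S^* * gamma ^+ (m * k i)))).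
      apply: eq_bigr => i _; rewrite cdotD cdotZ !cdot_delta !mxE.
      rewrite mul0n expr0 mulr1 rmorphM /= c0_conj normCK -c0_sqr.
      have g1 := gamma_conj (m * k i).
      rewrite !rmorphD !rmorphM /= !conjCK c0_conj.
      set g := gamma ^+ _ in g1 *.
      by ring: g1.
    rewrite -mulr_sumr big_split /= sumr_const big_split /= -!mulr_sumr.
    by rewrite -rmorph_sum -/S mulr_natl.
  rewrite -mulrA => /mulfI.
  have sN_neq0 : (s / N%:R)%:C%C != 0 :> R[i].
    by rewrite (inj_eq (@complexI _)) gt_eqF.
  (* Cancelling the common term leaves twice the squared modulus of [S] equal to 0. *)
  move=> /(_ sN_neq0) /eqP; rewrite -subr_eq0.
  rewrite addrAC subrr add0r [S^* * S]mulrC -mulr2n mulrn_eq0 /=.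
  by rewrite mulf_eq0 conjC_eq0 orbb => /eqP.
exists (s / N%:R * #|I|%:R); first by rewrite mulr_gt0 ?ltr0n.
move=> x; rewrite sum_cdot_HTF [in RHS]rmorphM /= rmorph_nat -[RHS]mulrA.
congr (_ * _).
rewrite /cdot [RHS]mulr_sumr; apply: eq_bigr => a _.
rewrite (bigD1 a) //= [X in _ + X]big1 ?addr0 => [|b ba].
  rewrite mulrC; congr (_ * _).
  by under eq_bigr do rewrite gamma_conj; rewrite sumr_const.
suff -> : \sum_i gamma ^+ (b * k i) * (gamma ^+ (a * k i))^* = 0.
  by rewrite mulr0.
(* The product is [gamma] to the power [(n - m) * k i]; natural subtraction needs [m < n], and
   conjugation gives the opposite order. *)
have sub m n : (m < n < N)%N ->
    \sum_i gamma ^+ (n * k i) * (gamma ^+ (m * k i))^* = 0.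
  move=> /andP[mn nN]; rewrite -[RHS](gamma0 (n - m)%N) ?subn_gt0 ?mn; last first.
    by rewrite (leq_ltn_trans (leq_subr _ _)).
  apply: eq_bigr => i _.
  by rewrite -{1}(subnK (ltnW mn)) mulnDl exprD -mulrA gamma_conj mulr1.
have [ab|ba'|/val_inj ab] := ltngtP a b.
- by rewrite sub // ab ltn_ord.
- apply: (can_inj (@conjCK _)); rewrite rmorph0 rmorph_sum -[RHS](sub b a).
        by apply: eq_bigr => i _; rewrite rmorphM /= conjCK mulrC.
  by rewrite ba' ltn_ord.
- by rewrite ab eqxx in ba.
Qed.

Lemma tight_subframe_HTF (J : {set 'I_M}) :
  tight_frame (subcollection (HTF N M s) J) <->
  (0 < #|J|)%N /\
  forall m, (0 < m < N)%N -> \sum_(k in J) gamma ^+ (m * k) = 0.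
Proof.
have cardJ : #|{: {i : 'I_M | i \in J}}| = #|J|.
  by rewrite card_sig; apply: eq_card.
have sumJ m : \sum_(k in J) gamma ^+ (m * k) =
    \sum_(i : {i : 'I_M | i \in J}) gamma ^+ (m * val i).
  by rewrite big_sub.
have [tightP tightI] := tight_frame_HTF _ (fun i : {i | i \in J} => val i).
split=> [/tightP|[J_gt0 J0]].
  by rewrite cardJ => -[J_gt0 J0]; split=> // m m_lt; rewrite sumJ J0.
by apply: tightI; rewrite cardJ; split=> // m m_lt; rewrite -sumJ J0.
Qed.

(** For [0 < m < N <= M], [M] does not divide [m], so each sum is geometric with ratio [gamma ^+ m]
    different from 1. *)
Lemma tight_HTF : (N <= M)%N -> tight_frame (HTF N M s).
Proof.
move=> NM; have M_gt0 := leq_trans N_gt0 NM.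
apply/(tight_frame_HTF _ id); rewrite card_ord; split=> // m /andP[m_gt0 m_lt].
have prim := expi_prim_root M M_gt0.
under eq_bigr do rewrite exprM.
apply: sum_root1; first by rewrite exprAC (prim_expr_order prim) expr1n.
by rewrite -(prim_order_dvd prim) gtnNdvd // (leq_trans m_lt).
Qed.

Lemma prime_HTF : (N <= M)%N -> divisor_set M N = set0 ->
  prime_tight_frame (HTF N M s).
Proof.
move=> NM D0; split; first exact: tight_HTF.
move=> J /properP[_ [j _ jJ]] /tight_subframe_HTF[J_gt0 J0].
have M_gt0 := leq_trans N_gt0 NM; have prim := expi_prim_root M M_gt0.
suff J00 : #|J| = 0%N by rewrite J00 in J_gt0.
apply: (card_fourier_eq0 _ _ _ J j prim jJ) => m /andP[m_gt0 m_lt].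
pose d := gcdn m M; have d_dvd : (d %| M)%N by rewrite dvdn_gcdr.
have d_gt0 : (0 < d)%N by rewrite gcdn_gt0 m_gt0.
have d_lt : (d < M)%N by rewrite (leq_ltn_trans _ m_lt) // dvdn_leq ?dvdn_gcdl.
(* A proper divisor satisfies [2 * d <= M], so [N <= d] would give [N <= M - d], that is
   [d <= M - N], and [d] would lie in the empty divisor set. *)
have dN : (d < N)%N.
  rewrite ltnNge; apply/negP => Nd.
  suff : divisor_set M N d by rewrite D0.
  split=> //; rewrite Nd /=; move: d_dvd d_lt => /dvdnP[q ->].
  rewrite -[X in (X < _)%N]mul1n ltn_pmul2r // => q_gt1.
  have := leq_mul2r d 2 q; rewrite q_gt1 orbT; lia.
have := J0 d; rewrite d_gt0 => /(_ dN).
(* As [m] and [d] have the same gcd with [M], both [gamma ^+ m] and [gamma ^+ d] are primitive roots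
   of order [M %/ d], and vanishing transfers from [d] to [m]. *)
have primE n : (M %/ gcdn n M).-primitive_root (gamma ^+ n).
  exact: exp_prim_root.
under eq_bigr do rewrite exprM; under [X in _ -> X = _]eq_bigr do rewrite exprM.
apply: sum_prim_root_conj (primE m).
by have := primE d; rewrite /d -gcdnA gcdnn.
Qed.

(* For a divisor [d] of [M], the multiples of [M / d] index a copy of
   HTF(N, d), which is tight as soon as [N <= d]. *)
Lemma not_prime_HTF d : divisor_set M N d -> ~ prime_tight_frame (HTF N M s).
Proof.
move=> [/andP[Nd dMN] d_dvd] [_ primeJ].
have d_gt0 := leq_trans N_gt0 Nd.
have d_lt : (d < M)%N by lia.
have M_gt0 : (0 < M)%N by lia.
have prim := expi_prim_root M M_gt0.
have e_gt0 : (0 < M %/ d)%N by rewrite divn_gt0 // dvdn_leq.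
have f_lt (i : 'I_d) : (i * (M %/ d) < M)%N.
  by rewrite -[X in (_ < X)%N](divnK d_dvd) mulnC ltn_pmul2l.
pose f i := Ordinal (f_lt i).
have f_inj : injective f.
  move=> i i' [/eqP]; rewrite eqn_pmul2r // => /eqP; exact: val_inj.
pose J := [set f i | i in 'I_d]%SET.
have cardJ : #|J| = d by rewrite card_imset // card_ord.
apply: (primeJ J); first by rewrite properEcard finset.subsetT cardJ cardsT card_ord.
apply/tight_subframe_HTF; rewrite cardJ; split=> // m /andP[m_gt0 m_lt].
rewrite big_imset /= => [|i i' _ _]; last exact: f_inj.
(* [w] is the [m]-th power of a primitive [d]-th root of unity, so [0 < m < N <= d] makes it
   different from 1. *)
pose w := gamma ^+ (m * (M %/ d)).
transitivity (\sum_(i < d) w ^+ i).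
  by apply: eq_bigr => i _; rewrite -exprM mulnCA mulnC.
apply: sum_root1.
  by rewrite -exprM -mulnA divnK // mulnC exprM (prim_expr_order prim) expr1n.
rewrite -(prim_order_dvd prim) -[X in (X %| _)%N](divnK d_dvd) mulnC.
by rewrite dvdn_pmul2r // gtnNdvd // (leq_trans m_lt).
Qed.

End HarmonicFrame.
End Frames.

Theorem theorem3p6 (R : realType) (N M : nat) (s : R)
    (hN : (2 <= N)%N) (hMN : (N <= M)%N) (hs : 0 < s) :
  (prime_tight_frame (HTF N M s) <-> divisor_set M N = set0) /\
  (prime M -> prime_tight_frame (HTF N M s)).
Proof.
have N_gt0 : (0 < N)%N by exact: ltnW.
split.
  split=> [primeF|]; last exact: prime_HTF.
  by rewrite -subset0 => d /(not_prime_HTF _ _ _ _ N_gt0 hs); apply.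
move=> M_prime; apply: prime_HTF => //; rewrite -subset0 => d [/andP[Nd dMN]].
(* The divisor 1 is below [N], and the divisor [M] exceeds [M - N]. *)
by case/primeP: M_prime => _ dvdM /dvdM /pred2P[] dE; lia.
Qed.
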